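(* Let $\mathcal{X}$ be a discrete-time birth-death process on $S=\{0,1,2,\dots\}$ with birth, death and self-transition probabilities $p_i>0$, $q_{i+1}>0$, $r_i\ge 0$ ($i\ge 0$), where $q_0=0$, $p_i+q_i+r_i=1$ for all $i\ge 0$, and $r_i>0$ for at least one $i$. Then $\mathcal{X}$ has asymptotic period $d(\mathcal{X})=\infty$ if and only if $\prod_{i=0}^\infty p_i>0$.
   Context: The birth-death process $\mathcal{X}=\{X(n),\,n=0,1,\dots\}$ is the homogeneous Markov chain on $S=\{0,1,2,\dots\}$ with 1-step transition probabilities $P(i,i+1)=p_i$, $P(i+1,i)=q_{i+1}$, $P(i,i)=r_i$ ($i\ge0$) and all others zero; it is stochastic, irreducible and aperiodic. The initial distribution is arbitrary and $\mathbb{P}$ is the induced probability measure on sample paths. For $m\ge 1$, $\mathcal{X}^{(m)}=\{X^{(m)}(n)=X(nm),\ n=0,1,\dots\}$ is the $m$-step chain. For a Markov chain $\mathcal{Y}=\{Y(n)\}$ on $S$ (here $\mathcal{X}$ or some $\mathcal{X}^{(m)}$) and $C\subset S$ let $U(C)=\{Y(n)\in C \text{ for infinitely many } n\}$ and $L(C)=\{Y(n)\in C\text{ for all sufficiently large }n\}$. $C$ is transient (w.r.t. $\mathcal{Y}$) if $\mathbb{P}(U(C))=0$; regular if $\mathbb{P}(U(C)\setminus L(C))=0$; almost closed if it is regular and not transient. These notions do not depend on the initial distribution. An almost closed set is atomic if it does not contain two disjoint almost closed subsets, and nonatomic otherwise. Two regular sets are equivalent if their symmetric difference is transient. A Blackwell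 decomposition of $S$ for $\mathcal{Y}$ is a finite or countable collection $\{C_1,C_2,\dots\}$ of disjoint almost closed sets such that (i) every $C_i$, except at most one, is atomic; (ii) the nonatomic $C_i$, if present, contains no atomic subsets and consists of transient states; (iii) $\sum_i\mathbb{P}(L(C_i))=1$. By a theorem of Blackwell such a decomposition exists and is unique up to equivalence; $\beta(\mathcal{Y})$ denotes the number of sets in it. $\mathcal{Y}$ is simple if $\beta(\mathcal{Y})=1$. (A birth-death process on $S=\{0,1,2,\dots\}$ with birth, death and self-transition probabilities $p_i>0$, $q_{i+1}>0$, $r_i\ge 0$ ($i\ge 0$), where $q_0=0$, $p_i+q_i+r_i=1$ for all $i\ge 0$, and $r_i>0$ for at least one $i$, is simple.) The asymptotic period of a simple chain $\mathcal{X}$ is $d(\mathcal{X}):=\sup\{m\ge1 : \beta(\mathcal{X}^{(m)})=m\}\in\{1,2,\dots\}\cup\{\infty\}$. *)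

(* Defs.v *)
From HB Require Import structures.
From mathcomp Require Import all_boot all_order all_algebra.
From mathcomp Require Import all_classical all_reals all_analysis.
Set Implicit Arguments.
Unset Strict Implicit.
Unset Printing Implicit Defensive.
Import Order.TTheory GRing.Theory Num.Theory.
Import numFieldNormedType.Exports.
Local Open Scope classical_set_scope.
Local Open Scope ring_scope.

(** Denumerable Markov chains on [nat], Blackwell decompositions and the
    asymptotic period.  A chain is represented by a sequence
    of random variables on an arbitrary probability space. *)

(** The Markov property in product form, which avoids conditioning on null
    events; nothing is imposed on the law of [X 0]. *)
Definition is_markov_chain (R : realType) (d : measure_display)
    (T : measurableType d) (P : probability T R) (X : nat -> {RV P >-> nat})
    (K : nat -> nat -> R) : Prop :=
  forall (n : nat) (s : nat -> nat),
    P [set w | forall k, (k <= n.+1)%N -> X k w = s k] =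
    (P [set w | forall k, (k <= n)%N -> X k w = s k] * (K (s n) (s n.+1))%:E)%E.

Definition birth_death_kernel (R : realType) (p q r : nat -> R) (i j : nat) : R :=
  if j == i.+1 then p i
  else if i == j.+1 then q i
  else if j == i then r i
  else 0.

Definition step_chain (R : realType) (d : measure_display)
    (T : measurableType d) (P : probability T R)
    (X : nat -> {RV P >-> nat}) (m : nat) : nat -> {RV P >-> nat} :=
  fun n => X (n * m)%N.

Section Blackwell.
Context (R : realType) (d : measure_display) (T : measurableType d)
  (P : probability T R).
Implicit Types (Y : nat -> {RV P >-> nat}) (A B C : set nat)
  (D : set (set nat)).

Definition inf_often Y C : set T := [set w | infinite_set [set n | C (Y n w)]].

Definition eventually_in Y C : set T := [set w | \forall n \near \oo, C (Y n w)].

Definition transient Y C : Prop := P (inf_often Y C) = 0%E.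

Definition regular Y C : Prop :=
  P (inf_often Y C `\` eventually_in Y C) = 0%E.

Definition almost_closed Y C : Prop := regular Y C /\ ~ transient Y C.

Definition has_disjoint_almost_closed Y C : Prop :=
  exists A B, [/\ A `<=` C, B `<=` C, A `&` B = set0,
                  almost_closed Y A & almost_closed Y B].

Definition atomic Y C : Prop :=
  almost_closed Y C /\ ~ has_disjoint_almost_closed Y C.

Definition nonatomic Y C : Prop :=
  almost_closed Y C /\ has_disjoint_almost_closed Y C.

(** Almost closed sets are nonempty and [nat] is countable, so a disjoint
    collection of them is automatically a countable set of sets, without
    repetitions.  A state [i] is transient when [[set i]] is. *)
Record blackwell_decomposition Y D : Prop := BlackwellDecomposition {
  bd_almost_closed : forall C, D C -> almost_closed Y C ;
  bd_disjoint : forall A B, D A -> D B -> A <> B -> A `&` B = set0 ;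
  bd_atomic : forall A B, D A -> D B -> nonatomic Y A -> nonatomic Y B -> A = B ;
  bd_nonatomic : forall C, D C -> nonatomic Y C ->
    (forall A, A `<=` C -> ~ atomic Y A) /\
    (forall i, C i -> transient Y [set i]) ;
  bd_total : (\esum_(C in D) P (eventually_in Y C) = 1)%E }.

(** The number of sets, possibly [+oo], of some Blackwell decomposition; it does
    not depend on which one is chosen, by Blackwell's uniqueness theorem. *)
Definition blackwell_number Y : \bar R :=
  counting (xget set0 [set D | blackwell_decomposition Y D]).

Definition asymptotic_period Y : \bar R :=
  ereal_sup [set m%:R%:E | m in
    [set m : nat | (1 <= m)%N /\ blackwell_number (step_chain Y m) = m%:R%:E]].

End Blackwell.

(* Main.v *)
Require Import Defs.
From HB Require Import structures.
From mathcomp Require Import all_boot all_order all_algebra.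
From mathcomp Require Import all_classical all_reals all_analysis.
From mathcomp Require Import ring lra zify.
Set Implicit Arguments.
Unset Strict Implicit.
Unset Printing Implicit Defensive.
Import Order.TTheory GRing.Theory Num.Theory.
Import numFieldNormedType.Exports.
Local Open Scope classical_set_scope.
Local Open Scope ring_scope.

(** Suppose [beta (X^(m)) = m] with [m >= 3].  Disjoint almost closed sets
    [C_1, C_2, C_3] of the [m]-step chain give bounded functions
    [h_k (x) = P_x (X (n m) in C_k eventually)] that are harmonic for the
    [m]-step kernel, have sum at most [1] and supremum [1], and so are linearly
    independent.  A function with [Pop (Pop f) = f], [Pop] being the one-step
    operator, is determined by [f 0] and [f 1], so some [h = h_k] has
    [Pop (Pop h) <> h].  The vectors
    [F n = (h n, Pop h n, ..., Pop^(m-1) h n)] satisfy [Pop F = S F] with [S]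
    the cyclic shift, an isometry of [R^m].  Hence [|F n|^2] is nondecreasing in
    [n], and its boundedness makes the energies
    [|F (n+1) - S F n|^2], [q_n |F (n-1) - S F n|^2] and [r_n |F n - S F n|^2]
    summable in [n].  Since [|F n - S^2 F n|] is nondecreasing and not
    identically zero, this forces [sum_n (q_n + r_n) < oo], that is
    [prod_n p_n > 0].

    Conversely, if [prod_n p_n > 0], the function [1 / prod_(j < i) p_j] is
    bounded with drift at least [1 - p_i], so by Borel-Cantelli the chain
    ultimately moves up at every step.  It can linger at a state with
    [r_i > 0], so every residue class mod [m] is eventually occupied by
    [X^(m)] with positive probability, and the [m] residue classes form, up to
    equivalence, the only Blackwell decomposition. *)

Lemma sum_cyclic_shift (V : zmodType) (m : nat) (g : nat -> V) :
  g m = g 0%N -> \sum_(k < m) g k.+1 = \sum_(k < m) g k.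
Proof.
case: m => [|m] gm; first by rewrite !big_ord0.
by rewrite big_ord_recr/= gm [RHS]big_ord_recl addrC.
Qed.

Section Birth_death_operator.
Context (R : realType) (p q r : nat -> R).

(** At [i = 0] the truncated predecessor yields [f 0], which is harmless because [q 0 = 0]. *)
Definition bd_op (f : nat -> R) (i : nat) : R :=
  p i * f i.+1 + q i * f i.-1 + r i * f i.

Context (p_gt0 : forall i, 0 < p i) (q0 : q 0%N = 0)
  (q_gt0 : forall i, 0 < q i.+1) (r_ge0 : forall i, 0 <= r i)
  (pqr1 : forall i, p i + q i + r i = 1).

Lemma q_ge0 i : 0 <= q i.
Proof. by case: i => [|i]; [rewrite q0|exact: ltW]. Qed.

Lemma p_le1 i : p i <= 1.
Proof. by have := pqr1 i; have := q_ge0 i; have := r_ge0 i; lra. Qed.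

(** * Energy identities for families shifted cyclically by the operator *)

Section Energy.
Context (m : nat) (F : nat -> nat -> R).
Context (F_step : forall k, F k.+1 = bd_op (F k))
  (F_per : forall k, F (k + m)%N = F k).

Let e n := \sum_(k < m) F k n ^+ 2.
Let up n := \sum_(k < m) (F k n.+1 - F k.+1 n) ^+ 2.
Let down n := \sum_(k < m) (F k n.-1 - F k.+1 n) ^+ 2.
Let stay n := \sum_(k < m) (F k n - F k.+1 n) ^+ 2.

(** Variance decomposition: [F k.+1 n] is the mean of [F k] over the three moves from [n], so the
    mean of the squares is the square of the mean plus the three weighted deviations. Summed over a
    full cycle in [k], the squared means add up to [e n] again. *)
Lemma energy_balance n :
  p n * (e n.+1 - e n) =
  q n * (e n - e n.-1) + (p n * up n + q n * down n + r n * stay n).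
Proof.
have eS : \sum_(k < m) F k.+1 n ^+ 2 = e n.
  by apply: (@sum_cyclic_shift _ _ (fun k => F k n ^+ 2)); rewrite -(F_per 0).
suff : p n * e n.+1 + q n * e n.-1 + r n * e n - \sum_(k < m) F k.+1 n ^+ 2 =
    p n * up n + q n * down n + r n * stay n.
  rewrite eS => <-.
  have -> : r n = 1 - p n - q n by have := pqr1 n; lra.
  by ring.
rewrite /e /up /down /stay !mulr_sumr -!big_split/= -sumrB.
apply: eq_bigr => k _; rewrite F_step /bd_op.
have -> : r n = 1 - p n - q n by have := pqr1 n; lra.
by ring.
Qed.

Lemma energy_terms_ge0 n : [/\ 0 <= up n, 0 <= down n & 0 <= stay n].
Proof. by split; apply: sumr_ge0 => k _; exact: sqr_ge0. Qed.

Lemma weighted_energy_ge0 n : 0 <= p n * up n + q n * down n + r n * stay n.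
Proof.
have [ux dx sx] := energy_terms_ge0 n; have q0n := q_ge0 n.
have p0n := ltW (p_gt0 n); have r0n := r_ge0 n.
by rewrite !addr_ge0 ?mulr_ge0.
Qed.

(** By [energy_balance], an increment inherits the sign of the preceding one; the induction starts
    because [q 0 = 0] removes the preceding increment at [0]. *)
Lemma energy_nondecreasing n : e n <= e n.+1.
Proof.
rewrite -subr_ge0 -(pmulr_rge0 _ (p_gt0 n)) energy_balance.
elim: n => [|n IHn]; first by rewrite {1}q0 mul0r add0r weighted_energy_ge0.
rewrite addr_ge0 ?weighted_energy_ge0// mulr_ge0 ?q_ge0//=.
by rewrite -(pmulr_rge0 _ (p_gt0 n)) energy_balance.
Qed.

(** Dividing [energy_balance] by [p n <= 1] leaves [up n] with full weight and can only enlarge the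
    other nonnegative terms. *)
Lemma energy_increment n :
  up n + q n * down n + r n * stay n <= e n.+1 - e n.
Proof.
have [ux dx sx] := energy_terms_ge0 n.
have qd := mulr_ge0 (q_ge0 n) dx; have rs := mulr_ge0 (r_ge0 n) sx.
have qe : 0 <= q n * (e n - e n.-1).
  case: n {ux dx sx qd rs} => [|n]; first by rewrite q0 mul0r.
  by rewrite mulr_ge0 ?q_ge0// subr_ge0 energy_nondecreasing.
have ebal := energy_balance n.
rewrite -(ler_pM2l (p_gt0 n)) ebal.
have p1 := p_le1 n; have pn := p_gt0 n; nra.
Qed.

Lemma energy_sum_le (B : R) N : (forall n, e n <= B) ->
  \sum_(0 <= n < N) (up n + q n * down n + r n * stay n) <= B.
Proof.
move=> eB; apply: le_trans (eB N).
apply: (@le_trans _ _ (e N - e 0%N)); last first.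
  by rewrite gerBl sumr_ge0// => k _; exact: sqr_ge0.
elim: N => [|N IHN]; first by rewrite big_geq// subrr.
rewrite big_nat_recr//= (_ : e N.+1 - e 0%N = (e N - e 0%N) + (e N.+1 - e N)).
  by rewrite lerD// energy_increment.
by ring.
Qed.

Let w n := \sum_(k < m) (F k n - F k.+2 n) ^+ 2.

Lemma sqrD_le (a b : R) : (a + b) ^+ 2 <= 2 * a ^+ 2 + 2 * b ^+ 2.
Proof. by have := sqr_ge0 (a - b); nra. Qed.

(** With [S] the cyclic shift, [F n - S^2 F n] is the sum of [F n - S F n] and its image under the
    isometry [S]. *)
Lemma defect_le_stay n : w n <= 4 * stay n.
Proof.
have stayS : \sum_(k < m) (F k.+1 n - F k.+2 n) ^+ 2 = stay n.
  apply: (@sum_cyclic_shift _ _ (fun k => (F k n - F k.+1 n) ^+ 2)).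
  by rewrite -(F_per 0) -(F_per 1) add1n.
have : w n <= 2 * stay n + 2 * \sum_(k < m) (F k.+1 n - F k.+2 n) ^+ 2.
  rewrite !mulr_sumr -big_split/=; apply: ler_sum => k _.
  apply: le_trans (sqrD_le _ _); rewrite le_eqVlt; apply/orP; left; apply/eqP.
  by congr (_ ^+ 2); ring.
by rewrite stayS; lra.
Qed.

(** The difference of [F n.+1] and [S^2 F n.+1] is split at the intermediate vector [S F n]; the
    second half is the image under [S] of the difference measured by [down n.+1]. *)
Lemma defect_le_down n : w n.+1 <= 2 * up n + 2 * down n.+1.
Proof.
have downS : \sum_(k < m) (F k.+1 n - F k.+2 n.+1) ^+ 2 = down n.+1.
  apply: (@sum_cyclic_shift _ _ (fun k => (F k n - F k.+1 n.+1) ^+ 2)).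
  by rewrite -(F_per 0) -(F_per 1) add1n.
rewrite -downS !mulr_sumr -big_split/=; apply: ler_sum => k _.
apply: le_trans (sqrD_le _ _); rewrite le_eqVlt; apply/orP; left; apply/eqP.
by congr (_ ^+ 2); ring.
Qed.

End Energy.

Lemma bd_opB (f g : nat -> R) i :
  bd_op (fun j => f j - g j) i = bd_op f i - bd_op g i.
Proof. by rewrite /bd_op; ring. Qed.

(** From [n0] on the squared defect is at least its positive value at [n0], while its products with
    [q n] and [r n] are controlled by energies of total at most [B]. Hence [q n + r n = 1 - p n] is
    summable. *)
Lemma energy_summable (m : nat) (F : nat -> nat -> R) (B : R) (n0 : nat) :
  (forall k, F k.+1 = bd_op (F k)) -> (forall k, F (k + m)%N = F k) ->
  (forall n, \sum_(k < m) F k n ^+ 2 <= B) ->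
  0 < \sum_(k < m) (F k n0 - F k.+2 n0) ^+ 2 ->
  exists M, forall N, \sum_(0 <= n < N) (1 - p n) <= M.
Proof.
move=> F_step F_per eB w0.
pose w n := \sum_(k < m) (F k n - F k.+2 n) ^+ 2.
(* The family [F k - F k.+2] is again cyclic and carried along by the operator, so its own energy is
   nondecreasing. *)
have w_mono n : w n <= w n.+1.
  apply: (@energy_nondecreasing m (fun k n => F k n - F k.+2 n)).
  - by move=> k; apply/funext => i; rewrite bd_opB -!F_step.
  - by move=> k; apply/funext => i; rewrite -(F_per k) -(F_per k.+2).
have w_ge n : (n0 <= n)%N -> w n0 <= w n.
  elim: n => [|n IHn]; first by rewrite leqn0 => /eqP->.
  rewrite leq_eqVlt => /orP[/eqP->//|n0n].
  by apply: le_trans (w_mono n); exact: IHn.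
pose term n := \sum_(k < m) (F k n.+1 - F k.+1 n) ^+ 2 +
  q n * (\sum_(k < m) (F k n.-1 - F k.+1 n) ^+ 2) +
  r n * \sum_(k < m) (F k n - F k.+1 n) ^+ 2.
have term_le N : \sum_(0 <= n < N) term n <= B by exact: energy_sum_le.
have stepw n : (n0 <= n)%N -> w n0 * (1 - p n.+1) <= 2 * term n + 4 * term n.+1.
  move=> n0n; have -> : 1 - p n.+1 = q n.+1 + r n.+1 by have := pqr1 n.+1; lra.
  rewrite /term.
  have [u0 d0 s0] := energy_terms_ge0 m F n.
  have [u1 d1 s1] := energy_terms_ge0 m F n.+1.
  have := defect_le_down F_per n; have := defect_le_stay F_per n.+1.
  have := w_ge _ (leq_trans n0n (leqnSn n)).
  move: u0 d0 s0 u1 d1 s1; rewrite -/(w n.+1).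
  set U0 := \sum_(k < m) _; set D0 := \sum_(k < m) _; set S0 := \sum_(k < m) _.
  set U1 := \sum_(k < m) _; set D1 := \sum_(k < m) _; set S1 := \sum_(k < m) _.
  move=> u0 d0 s0 u1 d1 s1 ww ws wd.
  have := q_gt0 n; have := r_ge0 n.+1.
  have qd := mulr_ge0 (q_ge0 n) d0; have rs := mulr_ge0 (r_ge0 n) s0.
  move=> r1 q1.
  have q2 : q n.+1 * w n0 <= 2 * U0 + 2 * (q n.+1 * D1).
    have qle1 : q n.+1 <= 1 by have := pqr1 n.+1; have := p_gt0 n.+1; lra.
    by nra.
  have r2 : r n.+1 * w n0 <= 4 * (r n.+1 * S1) by nra.
  have := mulr_ge0 (ltW q1) d1.
  by lra.
have term0 n : 0 <= term n.
  have [u0 d0 s0] := energy_terms_ge0 m F n.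
  by rewrite /term !addr_ge0// mulr_ge0// q_ge0.
clearbody term.
(* Indices up to [n0] are estimated by [1 - p n <= 1], and [(minn n0 N).+1] counts them; later ones
   use [stepw]. *)
have key N : w n0 * \sum_(0 <= n < N.+1) (1 - p n) <=
    w n0 * (minn n0 N).+1%:R + 2 * \sum_(0 <= n < N) term n +
      4 * \sum_(0 <= n < N.+1) term n.
  elim: N => [|N IHN].
    rewrite minn0 !big_nat1 big_geq// mulr1 mulr0 addr0.
    have := p_gt0 0%N; have := term0 0%N; move: w0; rewrite -/(w n0); nra.
  rewrite big_nat_recr//= [X in 2 * X]big_nat_recr//=.
  rewrite [X in 4 * X]big_nat_recr//= !mulrDr.
  have [n0N|Nn0] := leqP n0 N.
    have := stepw _ n0N; move: IHN.
    by rewrite (minn_idPl n0N) (minn_idPl (leq_trans n0N (leqnSn N))); lra.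
  move: IHN; rewrite (minn_idPr Nn0) (minn_idPr (ltnW Nn0)).
  have -> : N.+2%:R = N.+1%:R + 1 :> R by rewrite -natr1.
  have := p_gt0 N.+1; have := term0 N.+1; have := term0 N.
  move: w0; rewrite -/(w n0); nra.
exists ((w n0 * n0.+1%:R + 6 * B) / w n0) => N.
rewrite ler_pdivlMr// mulrC.
apply: (@le_trans _ _ (w n0 * \sum_(0 <= n < N.+1) (1 - p n))).
  rewrite ler_pM2l// big_nat_recr//= lerDl subr_ge0; exact: p_le1.
apply: le_trans (key N) _.
have : w n0 * (minn n0 N).+1%:R <= w n0 * n0.+1%:R.
  by rewrite ler_pM2l// ler_nat ltnS geq_minl.
by have := term_le N; have := term_le N.+1; lra.
Qed.

(** * Linearity, monotonicity and continuity of the iterated operator *)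

Lemma bd_op_cst (c : R) : bd_op (fun=> c) = fun=> c.
Proof.
apply/funext => i; rewrite /bd_op.
have -> : r i = 1 - p i - q i by have := pqr1 i; lra.
by ring.
Qed.

Lemma iter_bd_op_cst n (c : R) : iter n bd_op (fun=> c) = fun=> c.
Proof. by elim: n => //= n ->; rewrite bd_op_cst. Qed.

Lemma bd_op_le (f g : nat -> R) :
  (forall i, f i <= g i) -> forall i, bd_op f i <= bd_op g i.
Proof.
move=> fg i; have p0 := ltW (p_gt0 i); have q0i := q_ge0 i.
by rewrite /bd_op !lerD// ler_wpM2l.
Qed.

Lemma iter_bd_op_le n (f g : nat -> R) :
  (forall i, f i <= g i) -> forall i, iter n bd_op f i <= iter n bd_op g i.
Proof. by move=> fg; elim: n => //= n IHn; exact: bd_op_le. Qed.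

Lemma bd_op_lincomb (I : finType) (c : I -> R) (f : I -> nat -> R) :
  bd_op (fun i => \sum_k c k * f k i) = fun i => \sum_k c k * bd_op (f k) i.
Proof.
apply/funext => i; rewrite /bd_op !mulr_sumr -!big_split/=.
by apply: eq_bigr => k _; ring.
Qed.

Lemma iter_bd_op_lincomb n (I : finType) (c : I -> R) (f : I -> nat -> R) :
  iter n bd_op (fun i => \sum_k c k * f k i) =
  fun i => \sum_k c k * iter n bd_op (f k) i.
Proof. by elim: n => //= n ->; rewrite bd_op_lincomb. Qed.

Lemma iter_bd_opZ n (c : R) (f : nat -> R) :
  iter n bd_op (fun i => c * f i) = fun i => c * iter n bd_op f i.
Proof.
by elim: n => //= n ->; apply/funext => i; rewrite /bd_op; ring.
Qed.

Lemma iter_bd_op_cvg n (f_ : nat -> nat -> R) (g : nat -> R) :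
  (forall i, f_ k i @[k --> \oo] --> g i) ->
  forall i, iter n bd_op (f_ k) i @[k --> \oo] --> iter n bd_op g i.
Proof.
move=> fg; elim: n => //= n IHn i.
by apply: cvgD; [apply: cvgD|]; apply: cvgMr.
Qed.

(** * Probabilities of staying in a set and of being trapped by it *)

Section Staying.
Context (C : set nat) (m : nat).

(** This is the probability, from [i], that the [m]-step chain is in [C] at its times [0] to [K];
    [future_stay] makes the link with the chain. *)
Fixpoint stay_prob (K : nat) : nat -> R :=
  if K is K'.+1 then fun i => \1_C i * iter m bd_op (stay_prob K') i
  else \1_C.

Lemma stay_prob_ge0 K i : 0 <= stay_prob K i.
Proof.
elim: K i => [|K IHK] i /=; first by rewrite indicE.
rewrite mulr_ge0// ?indicE//.
by have := @iter_bd_op_le m (fun=> 0) _ IHK i; rewrite iter_bd_op_cst.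
Qed.

Lemma stay_probS K i : stay_prob K.+1 i <= stay_prob K i.
Proof.
elim: K i => [|K IHK] i; last first.
  by rewrite ler_wpM2l ?indicE//; exact: iter_bd_op_le.
rewrite -[leRHS]mulr1 ler_wpM2l ?indicE//.
have := @iter_bd_op_le m \1_C (fun=> 1) _ i; rewrite iter_bd_op_cst.
by apply=> j; rewrite indicE lern1 leq_b1.
Qed.

Lemma is_cvg_stay_prob i : cvgn (stay_prob ^~ i).
Proof.
apply: nonincreasing_is_cvgn.
  by apply/nonincreasing_seqP => K; exact: stay_probS.
by exists 0 => _ [K _ <-]; exact: stay_prob_ge0.
Qed.

Definition stay_forever (i : nat) : R := limn (stay_prob ^~ i).

Lemma cvg_stay_prob i : stay_prob K i @[K --> \oo] --> stay_forever i.
Proof. exact: is_cvg_stay_prob. Qed.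

Lemma stay_forever_ge0 i : 0 <= stay_forever i.
Proof.
apply: limr_ge; first exact: is_cvg_stay_prob.
by apply: nearW => K; exact: stay_prob_ge0.
Qed.

Lemma stay_forever_le_indic i : stay_forever i <= \1_C i.
Proof.
apply: limr_le; first exact: is_cvg_stay_prob.
apply: nearW; elim=> [//|K IHK]; exact: le_trans (stay_probS K i) IHK.
Qed.

Lemma stay_forever_fix i :
  stay_forever i = \1_C i * iter m bd_op stay_forever i.
Proof.
have /cvg_lim <- // : stay_prob K.+1 i @[K --> \oo] -->
    \1_C i * iter m bd_op stay_forever i.
  by apply: cvgMr; apply: iter_bd_op_cvg => j; exact: cvg_stay_prob.
have : stay_prob K.+1 i @[K --> \oo] --> stay_forever i.
  by rewrite (cvg_shiftS (stay_prob ^~ i)); exact: cvg_stay_prob.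
by move/cvg_lim => ->.
Qed.

Lemma stay_forever_le i : stay_forever i <= iter m bd_op stay_forever i.
Proof.
rewrite {1}stay_forever_fix -[leRHS]mul1r ler_wpM2r ?indicE ?lern1 ?leq_b1//.
have := @iter_bd_op_le m (fun=> 0) _ stay_forever_ge0 i.
by rewrite iter_bd_op_cst.
Qed.

(* If [stay_forever <= s], iterating [stay_forever_fix] gives
   [stay_forever <= s * stay_prob K], hence
   [stay_forever <= s * stay_forever]. *)
Lemma stay_forever_sup (s : R) : s < 1 -> (forall i, stay_forever i <= s) ->
  forall i, stay_forever i = 0.
Proof.
move=> s1 us.
have usK K i : stay_forever i <= s * stay_prob K i.
  elim: K i => [|K IHK] i; rewrite stay_forever_fix/=.
    have [Ci|nCi] := boolP (i \in C).
      have := us i; rewrite stay_forever_fix indicE Ci mulr1//.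
    by rewrite indicE (negbTE nCi) mul0r mulr0.
  rewrite mulrCA ler_wpM2l ?indicE//.
  by have := iter_bd_op_le m IHK i; rewrite iter_bd_opZ.
move=> i; apply/eqP; rewrite eq_le stay_forever_ge0 andbT.
have : stay_forever i <= s * stay_forever i.
  apply: (@cvgr_to_ge _ \oo _ _ (fun K => s * stay_prob K i)).
    by apply: cvgMr; exact: cvg_stay_prob.
  by apply: nearW => K.
by have := stay_forever_ge0 i; nra.
Qed.

Let trap_prob_ N : nat -> R := iter (N * m) bd_op stay_forever.

(** The index [N] stands for the event of being in [C] from the [m]-step time [N] on, so the limit
    is the probability of being eventually in [C]. *)
Definition trap_prob (i : nat) : R := limn (trap_prob_ ^~ i).

Lemma trap_prob_nd i : nondecreasing_seq (trap_prob_ ^~ i).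
Proof.
apply/nondecreasing_seqP => N; rewrite /trap_prob_ mulSnr iterD.
exact: iter_bd_op_le stay_forever_le i.
Qed.

Lemma trap_prob_le1 N i : trap_prob_ N i <= 1.
Proof.
have := @iter_bd_op_le (N * m) stay_forever (fun=> 1) _ i.
rewrite iter_bd_op_cst; apply => j.
by apply: le_trans (stay_forever_le_indic j) _; rewrite indicE lern1 leq_b1.
Qed.

Lemma cvg_trap_prob i :
  iter (N * m) bd_op stay_forever i @[N --> \oo] --> trap_prob i.
Proof.
apply: nondecreasing_is_cvgn (trap_prob_nd i) _.
by exists 1 => _ [N _ <-]; exact: trap_prob_le1.
Qed.

Lemma stay_forever_le_trap_prob i : stay_forever i <= trap_prob i.
Proof.
by apply: (nondecreasing_cvgn_le (trap_prob_nd i) _ 0%N); exact: cvg_trap_prob.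
Qed.

Lemma trap_prob_ge0 i : 0 <= trap_prob i.
Proof.
exact: le_trans (stay_forever_ge0 i) (stay_forever_le_trap_prob i).
Qed.

Lemma trap_prob_harmonic : iter m bd_op trap_prob = trap_prob.
Proof.
apply/funext => i; apply/esym.
have : trap_prob_ N.+1 i @[N --> \oo] --> iter m bd_op trap_prob i.
  rewrite /trap_prob_; under eq_fun do rewrite mulSn iterD.
  by apply: iter_bd_op_cvg; exact: cvg_trap_prob.
move/cvg_lim => <-//; apply/esym.
have : trap_prob_ N.+1 i @[N --> \oo] --> trap_prob i.
  by rewrite (cvg_shiftS (trap_prob_ ^~ i)); exact: cvg_trap_prob.
by move/cvg_lim; exact.
Qed.

(** A uniform bound [1 - eps] on [trap_prob] would also bound [stay_forever], which would then
    vanish by [stay_forever_sup]. *)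
Lemma trap_prob_near1 (x : nat) (eps : R) : 0 < stay_forever x -> 0 < eps ->
  exists y, 1 - eps < trap_prob y.
Proof.
move=> ux e0; apply: contrapT => /forallNP trap_le.
move: ux; rewrite (@stay_forever_sup (1 - eps)) ?ltxx//; first by lra.
move=> i; apply: le_trans (stay_forever_le_trap_prob i) _.
by have /negP := trap_le i; rewrite -leNgt.
Qed.

End Staying.

(** * Three disjoint traps force summability *)

Lemma sum_trap_prob_le1 (I : finType) (C : I -> set nat) m i :
  (forall k l, k != l -> C k `&` C l = set0) ->
  \sum_k trap_prob (C k) m i <= 1.
Proof.
move=> Cdisj.
apply: (@cvgr_to_le _ \oo _ _
    (fun N => \sum_k iter (N * m) bd_op (stay_forever (C k) m) i)).
  apply: cvg_big => [|k _]; [exact: add_continuous|exact: cvg_trap_prob].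
apply: nearW => N.
have := @iter_bd_op_le (N * m)
  (fun j => \sum_k 1 * stay_forever (C k) m j) (fun=> 1) _ i.
rewrite iter_bd_op_cst iter_bd_op_lincomb.
under eq_bigr do rewrite mul1r.
apply=> j; under eq_bigr do rewrite mul1r.
(* [stay_forever (C k) m] vanishes off [C k], so by disjointness at most one summand at [j] is
   nonzero. *)
have [[k Ckj]|nC] := pselect (exists k, C k j).
  rewrite (bigD1 k)//= big1 ?addr0 => [|l lk].
    apply: le_trans (stay_forever_le_indic _ _ j) _.
    by rewrite indicE lern1 leq_b1.
  apply/eqP; rewrite eq_le stay_forever_ge0 andbT.
  apply: le_trans (stay_forever_le_indic _ _ j) _; rewrite indicE memNset//.
  move=> Clj; have : (C l `&` C k) j by [].
  by rewrite Cdisj.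
rewrite big1// => k _; apply/eqP; rewrite eq_le stay_forever_ge0 andbT.
apply: le_trans (stay_forever_le_indic _ _ j) _; rewrite indicE memNset//.
by move=> Ckj; apply: nC; exists k.
Qed.

(* [bd_op (bd_op f) n] contains [f n.+2] with the coefficient
   [p n * p n.+1], so [f] is determined by its first two values. *)
Lemma iter2_bd_op_determined (f : nat -> R) :
  iter 2 bd_op f = f -> f 0%N = 0 -> f 1%N = 0 -> forall n, f n = 0.
Proof.
move=> f2 f0 f1.
suff IH n k : (k <= n.+1)%N -> f k = 0 by move=> n; exact: (IH n).
elim: n k => [|n IHn] k; first by case: k => [|[|k]].
rewrite leq_eqVlt ltnS => /orP[/eqP->|/IHn//].
have := congr1 (fun g => g n) f2; rewrite /= /bd_op.
rewrite (IHn n) ?(IHn n.+1) ?(IHn n.-1.+1) ?(IHn n.-1) ?(IHn n.-1.-1); try lia.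
rewrite !(mulr0, addr0) => /eqP.
by rewrite !mulf_eq0 !(gt_eqF (p_gt0 _))/= => /eqP.
Qed.

(** Otherwise the three functions are determined by their values at [0] and [1], hence linearly
    dependent, which their size excludes. *)
Lemma exists_not_period2 (h : 'I_3 -> nat -> R) :
  (forall k i, 0 <= h k i) -> (forall i, \sum_k h k i <= 1) ->
  (forall k, exists y, 2^-1 < h k y) ->
  exists k i, h k i != iter 2 bd_op (h k) i.
Proof.
move=> h0 h1 hy; apply: contrapT => /forallNP all2.
have h2 k : iter 2 bd_op (h k) = h k.
  apply/funext => i; have /forallNP/(_ i)/negP := all2 k.
  by rewrite negbK => /eqP.
pose A := \matrix_(k < 3, j < 2) h k j.
have /rowV0Pn[c cA c0] : kermx A != 0.
  rewrite -mxrank_eq0 mxrank_ker -lt0n subn_gt0 ltnS.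
  exact: rank_leq_col.
have cA0 (j : 'I_2) : \sum_k c 0 k * h k j = 0.
  have /sub_kermxP/matrixP/(_ 0 j) := cA; rewrite !mxE => E; rewrite -[RHS]E.
  by apply: eq_bigr => k _; rewrite !mxE.
have lin0 i : \sum_k c 0 k * h k i = 0.
  apply: (@iter2_bd_op_determined (fun i => \sum_k c 0 k * h k i))
    (cA0 0) (cA0 1) i.
  rewrite iter_bd_op_lincomb; apply/funext => n.
  by apply: eq_bigr => k _; rewrite h2.
(* Where the function with the largest coefficient exceeds 1/2, the other two sum to less than 1/2
   and cannot cancel it. *)
pose k0 := [arg max_(k > ord0) `|c 0 k|]%O.
have ck0 k : `|c 0 k| <= `|c 0 k0|.
  by rewrite /k0; case: arg_maxP => //= l _; exact.
have ck0_gt0 : 0 < `|c 0 k0|.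
  rewrite lt_neqAle normr_ge0 andbT eq_sym; apply: contra_neq c0 => ck00.
  apply/rowP => k; rewrite mxE; apply/eqP; rewrite -normr_eq0 eq_le normr_ge0.
  by rewrite andbT -ck00.
have [y hk0] := hy k0.
have rest : \sum_(k | k != k0) h k y < 2^-1.
  have := h1 y; rewrite (bigD1 k0)//=; lra.
have := lin0 y; rewrite (bigD1 k0)//= => /eqP.
rewrite addr_eq0 => /eqP/(congr1 Num.norm); rewrite normrN normrM.
rewrite (ger0_norm (h0 _ _)) => E.
have : `|c 0 k0| * h k0 y <= `|c 0 k0| * \sum_(k | k != k0) h k y.
  rewrite E mulr_sumr; apply: le_trans (ler_norm_sum _ _ _) _.
  by apply: ler_sum => k _; rewrite normrM (ger0_norm (h0 _ _)) ler_wpM2r.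
by rewrite ler_pM2l//; lra.
Qed.

Lemma summable_of_three_traps (m : nat) (C : 'I_3 -> set nat) : (0 < m)%N ->
  (forall k l, k != l -> C k `&` C l = set0) ->
  (forall k, exists x, 0 < stay_forever (C k) m x) ->
  exists M, forall N, \sum_(0 <= n < N) (1 - p n) <= M.
Proof.
move=> m_gt0 Cdisj Cx.
have half : 0 < 2^-1 :> R by rewrite invr_gt0.
have [k|k [n0 kn0]] := @exists_not_period2
    (fun k => trap_prob (C k) m) (fun k => trap_prob_ge0 (C k) m)
    (fun i => sum_trap_prob_le1 m i Cdisj).
  have [x /trap_prob_near1/(_ half)[y hy]] := Cx k.
  by exists y; lra.
set h := trap_prob (C k) m in kn0.
have h01 i : 0 <= h i <= 1.
  rewrite trap_prob_ge0/= (le_trans _ (sum_trap_prob_le1 m i Cdisj))//.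
  rewrite (bigD1 k)//= lerDl sumr_ge0// => l _; exact: trap_prob_ge0.
(* Harmonicity of [h] for [m] steps makes its iterates cyclic; they take values in [[0, 1]], so the
   energy is at most [m]. The term [k = 0] gives the positive defect at [n0]. *)
apply: (@energy_summable m (fun k => iter k bd_op h) m%:R n0).
- by [].
- by move=> j; rewrite iterD trap_prob_harmonic.
- move=> n; have -> : m%:R = \sum_(j < m) 1 :> R by rewrite sumr_const card_ord.
  apply: ler_sum => j _; rewrite -[leRHS](expr1n _ 2%N) ler_sqr ?nnegrE//.
    have := @iter_bd_op_le j h (fun=> 1) _ n; rewrite iter_bd_op_cst; apply.
    by move=> i; have /andP[] := h01 i.
  have := @iter_bd_op_le j (fun=> 0) h _ n; rewrite iter_bd_op_cst; apply.
  by move=> i; have /andP[] := h01 i.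
- rewrite (bigD1 (Ordinal m_gt0))//=; apply: ltr_wpDr.
    by apply: sumr_ge0 => j _; exact: sqr_ge0.
  by rewrite exprn_even_gt0//= subr_eq0.
Qed.

(** * The infinite product: Weierstrass's inequality and the escape potential *)

Lemma prod_ge_1_sub_sum a b :
  1 - \sum_(a <= n < b) (1 - p n) <= \prod_(a <= n < b) p n.
Proof.
elim: b => [|b IHb]; first by rewrite !big_geq// subr0.
have [ab|ba] := leqP a b; last by rewrite !big_geq// subr0.
rewrite !big_nat_recr//=.
have P1 : \prod_(a <= n < b) p n <= 1.
  by apply: prodr_ile1 => n _; rewrite ltW//= p_le1.
by have := p_gt0 b; have := p_le1 b; nra.
Qed.

Lemma prod_gt0 a b : 0 < \prod_(a <= n < b) p n.
Proof. by apply: prodr_gt0. Qed.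

Lemma prod_nonincreasing : nonincreasing_seq (fun n => \prod_(0 <= i < n) p i).
Proof.
apply/nonincreasing_seqP => n; rewrite big_nat_recr//=.
by rewrite ler_piMr ?p_le1// ltW// prod_gt0.
Qed.

Lemma is_cvg_prod : cvgn (fun n => \prod_(0 <= i < n) p i).
Proof.
apply: nonincreasing_is_cvgn prod_nonincreasing _.
by exists 0 => _ [n _ <-]; rewrite ltW// prod_gt0.
Qed.

Lemma lim_prod_gt0_of_summable :
  (exists M, forall N, \sum_(0 <= n < N) (1 - p n) <= M) ->
  0 < limn (fun n => \prod_(0 <= i < n) p i).
Proof.
move=> [M SM]; pose S N := \sum_(0 <= n < N) (1 - p n).
(* Without such an [N0] the sums could gain 1/2 again and again and would pass [M]. Beyond [N0] the
   Weierstrass inequality keeps the product above 1/2. *)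
have [N0 SN0] : exists N0, forall N, S N <= S N0 + 2^-1.
  apply: contrapT => /forallNP H.
  have grow k : exists N, k%:R / 2 <= S N.
    elim: k => [|k [N SN]]; first by exists 0%N; rewrite /S big_geq// mul0r.
    have /existsNP[N' /negP] := H N; rewrite -ltNge => NN'.
    by exists N'; rewrite -natr1 mulrDl mul1r; move: NN' SN; lra.
  have [N] := grow (Num.bound (2 * M)).
  have := archi_boundP (_ : 0 <= 2 * M).
  rewrite mulr_ge0//; last by have := SM 0%N; rewrite big_geq.
  by move=> /(_ isT); have := SM N; rewrite -/(S N); lra.
apply: (@lt_le_trans _ _ ((\prod_(0 <= i < N0) p i) / 2)).
  by rewrite divr_gt0// prod_gt0.
apply: limr_ge; first exact: is_cvg_prod.
exists N0 => //= N N0N; rewrite [leRHS](@big_cat_nat _ _ _ N0)//=.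
rewrite ler_pM2l ?prod_gt0//; apply: le_trans (prod_ge_1_sub_sum _ _).
have := SN0 N; rewrite /S (@big_cat_nat _ _ _ N0 0 N)//=; lra.
Qed.

Lemma lim_prod_le n :
  limn (fun n => \prod_(0 <= i < n) p i) <= \prod_(0 <= i < n) p i.
Proof. exact: nonincreasing_cvgn_ge prod_nonincreasing is_cvg_prod n. Qed.

Definition escape_potential (i : nat) : R := (\prod_(0 <= j < i) p j)^-1.

(** The upward move contributes exactly [escape_potential i], since [p i] cancels the last factor.
    What remains is the potential, at least [1], weighted by [q i] and [r i]. *)
Lemma escape_potential_drift i :
  1 - p i <= bd_op escape_potential i - escape_potential i.
Proof.
rewrite /bd_op /escape_potential; case: i => [|i].
  rewrite q0 big_nat1 big_geq// invr1 mulfV ?gt_eqF//.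
  by have := pqr1 0%N; rewrite q0; lra.
rewrite /= !big_nat_recr//= !invfM.
have pr := prod_gt0 0 i; set Q := \prod_(0 <= j < i) p j in pr *.
have Q1 : Q <= 1 by apply: prodr_ile1 => n _; rewrite ltW//= p_le1.
have -> : r i.+1 = 1 - p i.+1 - q i.+1 by have := pqr1 i.+1; lra.
have pi0 := p_gt0 i; have pS0 := p_gt0 i.+1.
have -> : p i.+1 * (Q^-1 * (p i)^-1 * (p i.+1)^-1) + q i.+1 * Q^-1 +
   (1 - p i.+1 - q i.+1) * (Q^-1 * (p i)^-1) - Q^-1 * (p i)^-1 =
   Q^-1 * ((1 - p i.+1) + ((1 - p i.+1) - q i.+1) * ((p i)^-1 - 1)).
  by field; rewrite !gt_eqF.
have qle : q i.+1 <= 1 - p i.+1 by have := pqr1 i.+1; have := r_ge0 i.+1; lra.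
have ip1 : 1 <= (p i)^-1 by rewrite invf_ge1// p_le1.
have iQ1 : 1 <= Q^-1 by rewrite invf_ge1.
have := p_le1 i.+1; set x := (p i)^-1 in ip1 *; set y := Q^-1 in iQ1 *.
move=> p1; have /mulr_ge0 : 0 <= 1 - p i.+1 - q i.+1 by lra.
move=> /(_ (x - 1)); rewrite subr_ge0 => /(_ ip1).
by set z := _ * (x - 1); nra.
Qed.

(** The drift inequality telescopes along the iterates, and the potential lies between [0] and the
    inverse of the limit. The sum is the expected number of times below [N] at which the chain fails
    to move up. *)
Lemma sum_iter_escape_le N i : 0 < limn (fun n => \prod_(0 <= i < n) p i) ->
  \sum_(0 <= n < N) iter n bd_op (fun j => 1 - p j) i <=
  (limn (fun n => \prod_(0 <= i < n) p i))^-1.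
Proof.
move=> lim_gt0.
have W0 j : 0 <= escape_potential j by rewrite invr_ge0 ltW// prod_gt0.
have WL j : escape_potential j <= (limn (fun n => \prod_(0 <= i < n) p i))^-1.
  by rewrite lef_pV2 ?posrE ?prod_gt0// lim_prod_le.
have opB n (f g : nat -> R) :
    iter n bd_op (fun j => f j - g j) =
    fun j => iter n bd_op f j - iter n bd_op g j.
  by elim: n => //= n ->; apply/funext => j; rewrite bd_opB.
apply: (@le_trans _ _ (iter N bd_op escape_potential i - escape_potential i)).
  elim: N => [|N IHN]; first by rewrite big_geq//= subrr.
  rewrite big_nat_recr//=; have := iter_bd_op_le N escape_potential_drift i.
  by rewrite opB -iterSr/=; lra.
rewrite lerBlDr (@le_trans _ _ (limn (fun n => \prod_(0 <= i < n) p i))^-1)//.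
  by have := iter_bd_op_le N WL i; rewrite iter_bd_op_cst.
by rewrite lerDl.
Qed.

End Birth_death_operator.

(** * Countable covers and null events *)

Section Null_events.
Context (R : realType) (d : measure_display) (T : measurableType d)
  (P : probability T R).

Lemma exists_gt0_of_cover (E : set T) (F : nat -> set T) :
  measurable E -> (forall n, measurable (F n)) -> E `<=` \bigcup_n F n ->
  (0 < P E)%E -> exists n, (0 < P (F n))%E.
Proof.
move=> mE mF EF PE; apply: contrapT => /forallNP F0.
have := measure_sigma_subadditive P mF mE EF.
rewrite eseries0 => [|n _ _]; first by rewrite leNgt PE.
by apply/eqP; rewrite eq_le measure_ge0 andbT leNgt; exact/negP/F0.
Qed.

Lemma null_of_cover (E : set T) (F : nat -> set T) :
  measurable E -> (forall n, measurable (F n)) -> E `<=` \bigcup_n F n ->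
  (forall n, P (F n) = 0%E) -> P E = 0%E.
Proof.
move=> mE mF EF F0; apply/eqP; rewrite eq_le measure_ge0 andbT leNgt.
by apply/negP => /(exists_gt0_of_cover mE mF EF)[n]; rewrite F0 ltxx.
Qed.

End Null_events.

(** * Measurability of visits and positivity for almost closed sets *)

Section Chain_events.
Context (R : realType) (d : measure_display) (T : measurableType d)
  (P : probability T R).
Implicit Type Y : nat -> {RV P >-> nat}.

Lemma measurable_visit Y n (A : set nat) : measurable [set w | A (Y n w)].
Proof. exact: (@measurable_funPTI _ _ _ _ (Y n) A). Qed.

Lemma measurable_relation Y n k (A : nat -> nat -> Prop) :
  measurable [set w | A (Y n w) (Y k w)].
Proof.
rewrite (_ : [set _ | _] =
    \bigcup_i ([set w | Y n w = i] `&` [set w | A i (Y k w)])).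
  apply: bigcupT_measurable => i; apply: measurableI.
    exact: (@measurable_visit Y n [set i]).
  exact: (@measurable_visit Y k (A i)).
by apply/seteqP; split=> [w Aw|w [i _ [/= -> ]]]//; exists (Y n w).
Qed.

Lemma eventually_inE Y C : eventually_in Y C =
  \bigcup_N \bigcap_(n in [set n | (N <= n)%N]) [set w | C (Y n w)].
Proof.
by apply/seteqP; split=> w [N _ H]; exists N.
Qed.

Lemma measurable_eventually_in Y C : measurable (eventually_in Y C).
Proof.
rewrite eventually_inE; apply: bigcupT_measurable => N.
by apply: bigcap_measurableType => n _; exact: (@measurable_visit Y n C).
Qed.

Lemma infinite_setP (A : set nat) :
  infinite_set A <-> forall N, exists2 n, (N <= n)%N & A n.
Proof.
split=> [Ainf N|Aunb Afin].
  apply: contrapT => H; apply: Ainf.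
  apply: (@sub_finite_set _ _ `I_N); last exact: finite_II.
  move=> n An /=; rewrite ltnNge; apply/negP => Nn; apply: H.
  by exists n.

have [N Nub] : exists N, forall n, A n -> (n <= N)%N.
  have /finite_seqP[s As] := Afin.
  by exists (\max_(i <- s) i)%N => n; rewrite As/= => /leq_bigmax_seq; exact.
by have [n Nn /Nub] := Aunb N.+1; rewrite leqNgt Nn.
Qed.

Lemma inf_oftenE Y C : inf_often Y C = ~` eventually_in Y (~` C).
Proof.
apply/seteqP; split=> w.
  move=> /infinite_setP H [N _ HN]; have [n Nn Cn] := H N.
  exact: HN Nn Cn.
move=> H; apply/infinite_setP => N; apply: contrapT => HN; apply: H.
by exists N => // n Nn Cn; apply: HN; exists n.
Qed.

Lemma measurable_inf_often Y C : measurable (inf_often Y C).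
Proof.
by rewrite inf_oftenE; apply: measurableC; exact: measurable_eventually_in.
Qed.

Lemma eventually_in_inf_often Y C : eventually_in Y C `<=` inf_often Y C.
Proof.
move=> w [N _ HN]; apply/infinite_setP => k.
by exists (maxn N k); rewrite ?leq_maxr//; apply: HN; exact: leq_maxl.
Qed.

(** Regularity gives [inf_often] and [eventually_in] the same probability, so nontransience passes
    to the latter. *)
Lemma almost_closed_gt0 Y C :
  almost_closed Y C -> (0 < P (eventually_in Y C))%E.
Proof.
move=> [reg ntr]; rewrite lt_neqAle measure_ge0 andbT; apply/eqP => L0.
apply: ntr; rewrite /transient.
have mU := measurable_inf_often Y C; have mL := measurable_eventually_in Y C.
have -> : P (inf_often Y C) = (P (eventually_in Y C) +
    P (inf_often Y C `\` eventually_in Y C))%E.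
  rewrite -measureU ?setDIK//; last exact: measurableD.
  by rewrite setDUK//; exact: eventually_in_inf_often.
by rewrite -L0 add0e; exact: reg.
Qed.

End Chain_events.

(** * From the path form of the Markov property to the operator *)

Section Markov_property.
Context (R : realType) (p q r : nat -> R).
Context (p_gt0 : forall i, 0 < p i) (q0 : q 0%N = 0)
  (q_gt0 : forall i, 0 < q i.+1) (r_ge0 : forall i, 0 <= r i)
  (pqr1 : forall i, p i + q i + r i = 1).
Context (d : measure_display) (T : measurableType d) (P : probability T R)
  (X : nat -> {RV P >-> nat})
  (X_bd : is_markov_chain X (birth_death_kernel p q r)).

Let op := bd_op p q r.

(** No state above [i.+1] is charged from [i], so this finite sum is the whole row of the kernel. *)
Lemma kernel_sum (g : nat -> R) i :
  \sum_(0 <= j < i.+2) birth_death_kernel p q r i j * g j = op g i.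
Proof.
rewrite /op /bd_op big_nat_recr//= big_nat_recr//= /birth_death_kernel.
rewrite !eqxx.
have -> : (i == i.+1) = false by lia.
case: i => [|i]; first by rewrite big_geq// q0; ring.
rewrite big_nat_recr//= !eqxx.
have -> : (i == i.+2) = false by lia.
rewrite big_nat big1 => [|j /andP[_ ji]]; first by ring.
by rewrite !ifF ?mul0r//; lia.
Qed.

Definition path_event n (s : nat -> nat) : set T :=
  [set w | forall k, (k <= n)%N -> X k w = s k].

Definition extend n (s : nat -> nat) (y : nat) : nat -> nat :=
  fun k => if k == n.+1 then y else s k.

Lemma measurable_path_event n s : measurable (path_event n s).
Proof.
rewrite (_ : path_event n s =
    \bigcap_(k in [set k | (k <= n)%N]) [set w | X k w = s k]) //.
by apply: bigcap_measurableType => k _; exact: (measurable_visit X k [set s k]).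
Qed.
#[local] Hint Resolve measurable_path_event : core.

Lemma extend_last n s y : extend n s y n.+1 = y.
Proof. by rewrite /extend eqxx. Qed.

Lemma path_event_extend n s y :
  path_event n.+1 (extend n s y) = path_event n s `&` [set w | X n.+1 w = y].
Proof.
apply/seteqP; split=> w.
  move=> H; split; last by rewrite /= H// extend_last.
  by move=> k kn; rewrite H ?leqW// /extend ltn_eqF.
move=> [H Xy] k; rewrite leq_eqVlt => /orP[/eqP->|kn].
  by rewrite extend_last.
by rewrite /extend ltn_eqF// H.
Qed.

Lemma prob_extend n s y : P (path_event n.+1 (extend n s y)) =
  (P (path_event n s) * (birth_death_kernel p q r (s n) y)%:E)%E.
Proof.
rewrite [LHS]X_bd extend_last /extend ltn_eqF//.
congr (P _ * _)%E; apply/seteqP; split=> w H k kn; rewrite H//.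
  by rewrite ltn_eqF.
by rewrite ltn_eqF.
Qed.

Lemma path_event_cover n s :
  path_event n s `<=` \bigcup_y path_event n.+1 (extend n s y).
Proof.
by move=> w ws; exists (X n.+1 w) => //; rewrite path_event_extend.
Qed.

Lemma path_event_trivIset n s :
  trivIset setT (fun y => path_event n.+1 (extend n s y)).
Proof.
apply/trivIsetP => i j _ _ ij; rewrite -subset0 => w.
rewrite !path_event_extend.
by move=> [[_ /= iE] [_ /= jE]]; move: ij; rewrite -iE -jE eqxx.
Qed.

(* [E] is an event about the times [>= n], and [g x] is its probability when
   the chain is at [x] at time [n]; conditioning on whole paths makes the
   product form of the Markov property directly applicable. *)
Definition future n (E : set T) (g : nat -> R) : Prop :=
  forall s, P (path_event n s `&` E) = (P (path_event n s) * (g (s n))%:E)%E.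

Lemma future_setT n : future n setT (fun=> 1).
Proof. by move=> s; rewrite setIT mule1. Qed.

Lemma future_visit n (A : set nat) E g : future n E g ->
  future n ([set w | A (X n w)] `&` E) (fun i => \1_A i * g i).
Proof.
move=> Eg s; have [As|nAs] := pselect (A (s n)).
  rewrite indicE mem_set// mul1r -Eg; congr (P _).
  apply/seteqP; split=> w; first by case=> ? [].
  by case=> ws Ew; split=> //; split=> //=; rewrite ws.
rewrite indicE memNset// mul0r mule0 (_ : _ `&` _ = set0) ?measure0//.
by rewrite -subset0 => w [ws [/= ]]; rewrite ws.
Qed.

Lemma future_step n E g : measurable E -> future n.+1 E g -> future n E (op g).
Proof.
move=> mE Eg s.
have -> : path_event n s `&` E =
    \bigcup_y (path_event n.+1 (extend n s y) `&` E).
  rewrite -setI_bigcupl; congr (_ `&` _); apply/seteqP; split.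
    exact: path_event_cover.
  by move=> w [y _]; rewrite path_event_extend => -[].
rewrite measure_bigcup//; last 2 first.
- by move=> y _; exact: measurableI.
- by apply: trivIset_setIr; exact: path_event_trivIset.
have PK y : P (path_event n.+1 (extend n s y) `&` E) =
    (P (path_event n s) * (birth_death_kernel p q r (s n) y * g y)%:E)%E.
  by rewrite Eg prob_extend extend_last EFinM muleA.
have -> : \big[+%E/0%R]_(0 <= i <oo | i \in setT)
    P (path_event n.+1 (extend n s i) `&` E) =
    \big[+%E/0%R]_(0 <= i <oo) P (path_event n.+1 (extend n s i) `&` E).
  by apply: eq_eseriesl => i; rewrite in_setT.
(* The kernel vanishes beyond [(s n).+1], which cuts the series down to the sum in [kernel_sum]. *)
rewrite (@nneseries_split _ _ 0 (s n).+2)// add0n eseries0 ?adde0.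
  have PE : P (path_event n s) = (fine (P (path_event n s)))%:E.
    by rewrite fineK ?fin_num_measure.
  rewrite -kernel_sum PE -EFinM mulr_sumr -sumEFin.
  by apply: eq_bigr => y _; rewrite PK PE.
move=> y sy _; rewrite PK /birth_death_kernel !ifF ?mul0r ?mule0//.
all: by lia.
Qed.

Lemma future_iter k n E g :
  measurable E -> future (n + k) E g -> future n E (iter k op g).
Proof.
move=> mE; elim: k n => [|k IHk] n; first by rewrite addn0.
by rewrite addnS -addSn => /IHk Eg; exact: future_step.
Qed.

Lemma exists_path_event n E : measurable E -> (0 < P E)%E ->
  exists s, (0 < P (path_event n s `&` E))%E.
Proof.
move=> mE PE; elim: n => [|n [s Ps]].
  have [||y Py] := @exists_gt0_of_cover _ _ _ P E
      (fun y => path_event 0 (fun=> y) `&` E) mE _ _ PE.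
  - by move=> y; exact: measurableI.
  - move=> w Ew; exists (X 0%N w) => //; split=> // k.
    by rewrite leqn0 => /eqP->.
  - by exists (fun=> y).
have [|||y Py] := @exists_gt0_of_cover _ _ _ P (path_event n s `&` E)
    (fun y => path_event n.+1 (extend n s y) `&` E) _ _ _ Ps.
- exact: measurableI.
- by move=> y; exact: measurableI.
- move=> w [/path_event_cover[y _ wy] Ew]; by exists y.
- by exists (extend n s y).
Qed.

Definition stay_event (C : set nat) m N K : set T :=
  [set w | forall j, (j <= K)%N -> C (X ((N + j) * m)%N w)].

Lemma measurable_stay_event C m N K : measurable (stay_event C m N K).
Proof.
rewrite (_ : stay_event C m N K = \bigcap_(j in [set j | (j <= K)%N])
    [set w | C (X ((N + j) * m)%N w)]) //.
by apply: bigcap_measurableType => j _; exact: (measurable_visit X _ C).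
Qed.

Lemma future_stay C m N K :
  future (N * m) (stay_event C m N K) (stay_prob p q r C m K).
Proof.
elim: K N => [|K IHK] N.
  rewrite (_ : stay_event _ _ _ _ = [set w | C (X (N * m)%N w)] `&` setT).
    rewrite (_ : stay_prob _ _ _ _ _ _ = fun i => \1_C i * 1).
      by apply: future_visit; exact: future_setT.
    by apply/funext => i; rewrite mulr1.
  rewrite setIT; apply/seteqP; split=> w.
    by move=> /(_ 0%N isT); rewrite addn0.
  by move=> Cw j; rewrite leqn0 => /eqP->; rewrite addn0.
rewrite (_ : stay_event _ _ _ _ =
    [set w | C (X (N * m)%N w)] `&` stay_event C m N.+1 K).
  apply: future_visit; apply: future_iter; first exact: measurable_stay_event.
  by rewrite addnC -mulSn; exact: IHK.
apply/seteqP; split=> w.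
  move=> H; split; first by move: (H 0%N isT); rewrite addn0.
  by move=> j jK; rewrite addSnnS; exact: H.
by move=> [H0 H] [|j] jK; [rewrite addn0|rewrite -addSnnS; exact: H].
Qed.

(** Some event of being in [C] from time [N] on has positive probability, already along one path up
    to time [N * m]. The Markov property bounds that probability by [stay_prob K] at the end of the
    path, for every [K]. *)
Lemma eventually_in_stay_forever C m :
  (0 < P (eventually_in (step_chain X m) C))%E ->
  exists x, 0 < stay_forever p q r C m x.
Proof.
rewrite eventually_inE => PL.
pose S N :=
  \bigcap_(n in [set n | (N <= n)%N]) [set w | C (step_chain X m n w)].
have mS N : measurable (S N).
  apply: bigcap_measurableType => n _.
  exact: (measurable_visit (step_chain X m) n C).
have [N PS] : exists N, (0 < P (S N))%E.
  exact: (@exists_gt0_of_cover _ _ _ P _ S (bigcupT_measurable _ mS) mS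
    (fun _ => id) PL).
have [s Ps] := exists_path_event (N * m) (mS N) PS.
exists (s (N * m)%N).
set a := P _ in Ps; set b := P (path_event (N * m) s).
have afin : a \is a fin_num by apply: fin_num_measure; exact: measurableI.
have bfin : b \is a fin_num by rewrite fin_num_measure.
apply: (@lt_le_trans _ _ (fine a)).
  by rewrite fine_gt0 ?Ps ?ltey_eq ?afin.
apply: limr_ge; first exact: is_cvg_stay_prob.
apply: nearW => K; rewrite -lee_fin fineK//.
apply: (@le_trans _ _ (b * (stay_prob p q r C m K (s (N * m)%N))%:E)%E).
  rewrite -future_stay; apply: le_measure; rewrite ?inE.
  - exact: measurableI.
  - by apply: measurableI => //; exact: measurable_stay_event.
  - by move=> w [ws wS]; split=> // j jK; apply: wS => /=; exact: leq_addr.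
rewrite -[leRHS]mul1e lee_wpmul2r ?lee_fin ?stay_prob_ge0//.
exact: probability_le1.
Qed.

(** * Ultimate ascent when the infinite product is positive *)

Let not_up n := [set w | X n.+1 w <> (X n w).+1].

Lemma measurable_not_up n : measurable (not_up n).
Proof. exact: (measurable_relation X n n.+1 (fun i j => j <> i.+1)). Qed.

Lemma kernel_up i : birth_death_kernel p q r i i.+1 = p i.
Proof. by rewrite /birth_death_kernel eqxx. Qed.

Lemma future_not_up n : future n (not_up n) (fun i => 1 - p i).
Proof.
move=> s.
have E : P (path_event n s) = (P (path_event n s `&` not_up n) +
    P (path_event n.+1 (extend n s (s n).+1)))%E.
  have mnu := measurable_not_up n.
  rewrite -measureU//; last 2 first.
  - exact: measurableI (measurable_path_event n s) mnu.
  - rewrite -subset0 => w [[ws nu]]; rewrite path_event_extend => -[_ /= up].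
    by apply: nu; rewrite (ws n).
  congr (P _); apply/seteqP; split=> w.
    move=> ws; have [up|nu] := pselect (X n.+1 w = (X n w).+1); last by left.
    by right; rewrite path_event_extend; split=> //=; rewrite up ws.
  by case=> [[]|]//; rewrite path_event_extend => -[].
move: E; rewrite prob_extend kernel_up.
have : P (path_event n s) \is a fin_num by rewrite fin_num_measure.
have : P (path_event n s `&` not_up n) \is a fin_num.
  apply: fin_num_measure; apply: measurableI => //; exact: measurable_not_up.
case: (P (path_event n s)) => // b; case: (P (_ `&` _)) => // a _ _.
by rewrite -EFinM -EFinD => -[E]; congr (_%:E); rewrite mulrBr mulr1 {1}E; ring.
Qed.

Context (lim_gt0 : 0 < limn (fun n => \prod_(0 <= i < n) p i)).
Let L := limn (fun n => \prod_(0 <= i < n) p i).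

(** Borel-Cantelli: given the initial state, the failures to move up have probabilities of sum at
    most [L^-1], by [sum_iter_escape_le]. *)
Lemma path_event0_lim_sup_not_up s :
  P (lim_sup_set (fun n => path_event 0 s `&` not_up n)) = 0%E.
Proof.
have mF n : measurable (path_event 0 s `&` not_up n).
  apply: measurableI => //; exact: measurable_not_up.
apply: lim_sup_set_cvg0 => //.
set b := P (path_event 0 s).
apply: (@le_lt_trans _ _ (b * (L^-1)%:E)%E); last first.
  by rewrite ltey_eq fin_numM// fin_num_measure.
apply: lime_le; first by apply: is_cvg_nneseries.
apply: nearW => N.
have b0 : 0 <= fine b by rewrite fine_ge0 ?measure_ge0.
have bE : b = (fine b)%:E by rewrite fineK ?fin_num_measure.
have PE n : P (path_event 0 s `&` not_up n) =
    (fine b * iter n op (fun j => 1 - p j) (s 0%N))%:E.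
  rewrite EFinM -bE; apply: future_iter; first exact: measurable_not_up.
  exact: future_not_up.
rewrite (eq_bigr _ (fun n _ => PE n)).
rewrite sumEFin bE -EFinM lee_fin -mulr_sumr ler_wpM2l//.
exact: (sum_iter_escape_le p_gt0 q0 q_gt0 r_ge0 pqr1).
Qed.

Definition ultimately_up : set T :=
  [set w | exists N, forall n, (N <= n)%N -> X n.+1 w = (X n w).+1].

Lemma ultimately_upE :
  ultimately_up = \bigcup_N \bigcap_(n in [set n | (N <= n)%N]) ~` not_up n.
Proof.
apply/seteqP; split=> w [N].
  by move=> H; exists N => // n /= Nn; rewrite notK; exact: H.
by move=> _ H; exists N => n Nn; have := H n Nn; rewrite /= notK.
Qed.

Lemma measurable_ultimately_up : measurable ultimately_up.
Proof.
rewrite ultimately_upE; apply: bigcupT_measurable => N.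
apply: bigcap_measurableType => n _; apply: measurableC.
exact: measurable_not_up.
Qed.

Lemma ultimately_up_ae : P (~` ultimately_up) = 0%E.
Proof.
apply: (@null_of_cover _ _ _ P _
  (fun y => lim_sup_set (fun n => path_event 0 (fun=> y) `&` not_up n))).
- by apply: measurableC; exact: measurable_ultimately_up.
- move=> y; apply: bigcapT_measurable => n; apply: bigcup_measurable => k _.
  by apply: measurableI => //; exact: measurable_not_up.
- move=> w; rewrite ultimately_upE => nw; exists (X 0%N w) => // n _.
  apply: contrapT => H; apply: nw; exists n => // k nk nu.
  apply: H; exists k => //; split=> // j.
  by rewrite leqn0 => /eqP->.
- by move=> y; exact: path_event0_lim_sup_not_up.
Qed.

Definition up_event n K : set T :=
  [set w | forall j, (j < K)%N -> X (n + j).+1 w = (X (n + j)%N w).+1].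

Lemma measurable_up_event n K : measurable (up_event n K).
Proof.
rewrite (_ : up_event n K =
    \bigcap_(j in [set j | (j < K)%N])
      [set w | X (n + j).+1 w = (X (n + j)%N w).+1]) //.
apply: bigcap_measurableType => j _.
exact: (measurable_relation X _ _ (fun i j => j = i.+1)).
Qed.

Lemma future_up n K :
  future n (up_event n K) (fun i => \prod_(i <= j < i + K) p j).
Proof.
elim: K n => [|K IHK] n s.
  rewrite addn0 big_geq// mule1; congr (P _).
  by apply/seteqP; split=> w; [case|move=> ?; split].
have -> : path_event n s `&` up_event n K.+1 =
    path_event n.+1 (extend n s (s n).+1) `&` up_event n.+1 K.
  rewrite path_event_extend; apply/seteqP; split=> w.
    move=> [ws H]; split; last by move=> j jK; rewrite addSnnS; exact: H.
    by split=> //=; have := H 0%N isT; rewrite addn0 (ws n).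
  move=> [[ws /= up0] H]; split=> // -[|j] jK.
    by rewrite addn0 up0 (ws n).
  by rewrite -addSnnS; exact: H.
rewrite IHK prob_extend extend_last kernel_up -muleA -EFinM addSnnS.
by rewrite [in RHS]big_ltn// addnS ltnS leq_addr.
Qed.

(** Given the path, [K] consecutive ascents have as probability a product of [p] starting at [s n].
    It is at least [L] for every [K], and the events decrease in [K]. *)
Lemma up_forever_gt0 n s : (0 < P (path_event n s))%E ->
  (0 < P (path_event n s `&` \bigcap_K up_event n K))%E.
Proof.
move=> Ps; rewrite setIC -bigcapIl; last by exists 0%N.
have mF K : measurable (up_event n K `&` path_event n s).
  by apply: measurableI => //; exact: measurable_up_event.
apply: (@lt_le_trans _ _ (P (path_event n s) * L%:E)%E).
  by rewrite mule_gt0// lte_fin.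
have : (P \o (fun K => up_event n K `&` path_event n s)) K @[K --> \oo] -->
    P (\bigcap_K (up_event n K `&` path_event n s)).
  apply: nonincreasing_cvg_mu => //.
  - by rewrite ltey_eq fin_num_measure.
  - exact: bigcapT_measurable.
  - move=> K K' KK'; apply/subsetPset => w [H ws]; split=> // j jK.
    by apply: H; exact: leq_trans jK KK'.
move/cvg_lim => <-//; apply: lime_ge.
  apply: ereal_nonincreasing_is_cvgn.
  apply/nonincreasing_seqP => K /=; apply: le_measure; rewrite ?inE//.
  by move=> w [H ws]; split=> // j jK; apply: H; exact: ltnW.
apply: nearW => K /=; rewrite setIC future_up lee_wpmul2l// lee_fin.
apply: le_trans (lim_prod_le p_gt0 q0 q_gt0 r_ge0 pqr1 (s n + K)) _.
rewrite (@big_cat_nat _ _ _ (s n))//= ?leq_addr// ler_piMl//.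
  by rewrite ltW// prod_gt0.
apply: prodr_ile1 => j _; rewrite ltW//=.
exact: (p_le1 q0 q_gt0 r_ge0 pqr1).
Qed.

(** * Reaching every residue class with positive probability *)

Definition reachable n x : Prop :=
  exists2 s, (0 < P (path_event n s))%E & s n = x.

Lemma reachable_step n x y :
  reachable n x -> 0 < birth_death_kernel p q r x y -> reachable n.+1 y.
Proof.
move=> [s Ps <-] K0; exists (extend n s y); last by rewrite extend_last.
by rewrite prob_extend mule_gt0.
Qed.

Lemma reachable_up n k x : reachable n x -> reachable (n + k) (x + k).
Proof.
move=> nx; elim: k => [|k IHk]; first by rewrite !addn0.
by rewrite !addnS; apply: reachable_step IHk _; rewrite kernel_up.
Qed.

Lemma reachable_down n k x : reachable n (x + k) -> reachable (n + k) x.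
Proof.
elim: k n => [|k IHk] n; first by rewrite !addn0.
rewrite addnS => nx; rewrite addnS -addSn; apply: IHk.
apply: reachable_step nx _.
by rewrite /birth_death_kernel ltn_eqF ?eqxx.
Qed.

Lemma reachable_stay n k x : 0 < r x -> reachable n x -> reachable (n + k) x.
Proof.
move=> rx nx; elim: k => [|k IHk]; first by rewrite addn0.
rewrite addnS; apply: reachable_step IHk _.
by rewrite /birth_death_kernel ltn_eqF// eqxx.
Qed.

Lemma reachable_all x : exists n, reachable n x.
Proof.
have [|s Ps] := @exists_path_event 0 setT measurableT.
  by rewrite probability_setT lte01.
have s0 : reachable 0 (s 0%N) by exists s => //; rewrite setIT in Ps.
have [sx|xs] := leqP (s 0%N) x.
  exists (x - s 0%N)%N; have := reachable_up (x - s 0)%N s0.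
  by rewrite add0n subnKC.
exists (s 0 - x)%N; have := @reachable_down 0 (s 0 - x)%N x.
by rewrite add0n subnKC ?(ltnW xs)//; exact.
Qed.

Definition residue_class m j : set nat := [set x | x = j %[mod m]].

Lemma residue_class_gt0 m j : (0 < m)%N -> (exists i, 0 < r i) ->
  (0 < P (eventually_in (step_chain X m) (residue_class m j)))%E.
Proof.
case: m => // m _ [x rx]; have [n0 nx] := reachable_all x.
(* The modulus is now [m.+1]. Lingering at [x] until time [n = n0 + x + m * (n0 + j)] and ascending
   ever after gives, at multiples of [m.+1], the residue of [x - n = j - m.+1 * (n0 + j)], that is
   of [j]. *)
have [s Ps sx] := reachable_stay (x + m * (n0 + j)) rx nx.
set n := (n0 + _)%N in Ps sx.
apply: lt_le_trans (up_forever_gt0 Ps) _.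
have mup : measurable (\bigcap_K up_event n K).
  by apply: bigcapT_measurable => K; exact: measurable_up_event.
apply: le_measure; rewrite ?inE.
- exact: measurableI.
- exact: measurable_eventually_in.
move=> w [ws wup].
have Xn k : X (n + k)%N w = (x + k)%N.
  elim: k => [|k IHk]; first by rewrite !addn0 ws.
  by rewrite !addnS (wup k.+1 I k)// IHk.
exists n => // N /= nN; rewrite /residue_class /= /step_chain.
have nNm : (n <= N * m.+1)%N by apply: leq_trans nN _; exact: leq_pmulr.
rewrite -(subnKC nNm) Xn.
have -> : (j = x + (N * m.+1 - n) %[mod m.+1])%N; last by [].
(* Adding multiples of the modulus on both sides turns the congruence into an equality. *)
rewrite -[in LHS](modnMDl N) -[in RHS](modnMDl (n0 + j)).
congr (_ %% _)%N; rewrite /n in nNm *.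
by move: nNm; rewrite [((n0 + j) * _)%N]mulnC mulSn; lia.
Qed.

End Markov_property.

(** * Blackwell decompositions of a chain that ultimately moves up *)

Section Upward_chain.
Context (R : realType) (d : measure_display) (T : measurableType d)
  (P : probability T R) (X : nat -> {RV P >-> nat}) (m : nat).
Context (m_gt0 : (0 < m)%N) (X_up : P (~` ultimately_up X) = 0%E).

Let Y := step_chain X m.
Let cls := residue_class m.

Context (cls_gt0 : forall j, (0 < P (eventually_in Y (cls j)))%E).

Lemma le_prob_on_up (A B : set T) : measurable A -> measurable B ->
  (forall w, ultimately_up X w -> A w -> B w) -> (P A <= P B)%E.
Proof.
move=> mA mB AB; have mU := measurable_ultimately_up X.
apply: (@le_trans _ _ (P (B `|` ~` ultimately_up X))).
  apply: le_measure; rewrite ?inE//.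
    by apply: measurableU => //; exact: measurableC.
  move=> w Aw; have [Uw|nU] := pselect (ultimately_up X w); last by right.
  by left; exact: AB.
apply: le_trans (measureU2 _ mB (measurableC mU)) _.
by rewrite [X in (_ + X)%E]X_up adde0.
Qed.

Lemma null_on_up (A B : set T) : measurable A -> measurable B ->
  (forall w, ultimately_up X w -> A w -> B w) -> P B = 0%E -> P A = 0%E.
Proof.
move=> mA mB AB B0; apply/eqP; rewrite eq_le measure_ge0 andbT.
by have := le_prob_on_up mA mB AB; rewrite B0.
Qed.

Lemma step_chain_up w : ultimately_up X w ->
  exists N, forall n i, (N <= n)%N -> Y (n + i)%N w = (Y n w + i * m)%N.
Proof.
move=> [N Nup]; exists N => n i Nn; rewrite /Y /step_chain mulnDl.
have Nnm : (N <= n * m)%N by apply: leq_trans Nn _; exact: leq_pmulr.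
elim: (i * m)%N => [|k IHk]; first by rewrite !addn0.
by rewrite !addnS Nup ?IHk// (leq_trans Nnm)// leq_addr.
Qed.

Lemma up_eventually_in_class w : ultimately_up X w ->
  exists2 j, (j < m)%N & eventually_in Y (cls j) w.
Proof.
move=> /step_chain_up[N HN]; exists (Y N w %% m)%N; first exact: ltn_pmod.
exists N => // n /= Nn; rewrite -(subnKC Nn) HN// /cls /residue_class /=.
by rewrite addnC modnMDl modn_mod.
Qed.

(** Ultimately [Y] advances by exactly [m], so such a path runs through all large members of its
    class. This reduces events to the combinatorics of subsets of [nat]. *)
Lemma up_inf_often w j A : ultimately_up X w -> eventually_in Y (cls j) w ->
  inf_often Y A w <-> infinite_set (A `&` cls j).
Proof.
move=> /step_chain_up[N0 HN0] [N1 _ HN1].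
have [N HN Nj] : exists2 N, forall i, Y (N + i)%N w = (Y N w + i * m)%N
    & forall n, (N <= n)%N -> cls j (Y n w).
  exists (maxn N0 N1) => [i|n]; first by rewrite HN0 ?leq_maxl.
  by rewrite geq_max => /andP[_]; exact: HN1.
split=> [/infinite_setP Yinf|/infinite_setP Ainf]; apply/infinite_setP => K.
  have [n Kn An] := Yinf (N + K)%N; have Nn := leq_trans (leq_addr _ _) Kn.
  exists (Y n w); last by split=> //; exact: Nj.
  rewrite -(subnKC Nn) HN; apply: leq_trans (leq_addl _ _).
  by apply: (@leq_trans (n - N)); [rewrite leq_subRL|exact: leq_pmulr].
(* A target this far above [Y N w] is met only after at least [K] further steps. *)
have [x xK [Ax xj]] := Ainf (Y N w + K * m)%N.
have xY : (Y N w <= x)%N := leq_trans (leq_addr _ _) xK.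
have /dvdnP[i xi] : (m %| x - Y N w)%N.
  by rewrite -eqn_mod_dvd//; apply/eqP; rewrite xj (Nj N).
exists (N + i)%N; last by rewrite /= HN -xi subnKC.
rewrite (leq_trans _ (leq_addl _ _))// -(leq_pmul2r m_gt0) -xi.
by rewrite leq_subRL.
Qed.

Lemma up_eventually_in w j A : ultimately_up X w -> eventually_in Y (cls j) w ->
  eventually_in Y A w <-> ~ infinite_set (~` A `&` cls j).
Proof.
move=> Uw jw; rewrite -(up_inf_often (~` A) Uw jw) inf_oftenE setCK.
by split=> [Aw|/contrapT].
Qed.

(** Each class is followed with positive probability, so an obstruction inside one class is not
    negligible; conversely almost every path ends up in some class. *)
Lemma regular_upE A : regular Y A <->
  forall j, infinite_set (A `&` cls j) -> ~ infinite_set (~` A `&` cls j).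
Proof.
have mreg : measurable (inf_often Y A `\` eventually_in Y A).
  by apply: measurableD; [exact: measurable_inf_often|
    exact: measurable_eventually_in].
split=> [reg j Aj nAj|H].
  have := cls_gt0 j; rewrite (@null_on_up _ _ _ mreg) ?ltxx//.
    exact: measurable_eventually_in.
  move=> w Uw jw; split; first exact/(up_inf_often A Uw jw).
  by move/(up_eventually_in A Uw jw).
apply: (@null_on_up _ set0) => //.
move=> w Uw [/= Aw nAw]; have [j _ jw] := up_eventually_in_class Uw.
by apply: nAw; apply/(up_eventually_in A Uw jw)/H/(up_inf_often A Uw jw).
Qed.

Lemma transient_upE A :
  transient Y A <-> forall j, ~ infinite_set (A `&` cls j).
Proof.
have mA := measurable_inf_often Y A.
split=> [tr j Aj|H].
  have := cls_gt0 j; rewrite (@null_on_up _ _ _ mA) ?ltxx//.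
    exact: measurable_eventually_in.
  by move=> w Uw jw; exact/(up_inf_often A Uw jw).
apply: (@null_on_up _ set0) => //.
move=> w Uw Aw; have [j _ jw] := up_eventually_in_class Uw.
by apply: (H j); exact/(up_inf_often A Uw jw).
Qed.

Lemma almost_closed_upE A : almost_closed Y A <->
  (forall j, infinite_set (A `&` cls j) -> ~ infinite_set (~` A `&` cls j)) /\
  exists j, infinite_set (A `&` cls j).
Proof.
rewrite /almost_closed regular_upE transient_upE.
split=> -[H1 H2]; split=> //.
  by apply: contrapT => /forallNP; exact: H2.
by case: H2 => j Aj /(_ j).
Qed.

Lemma infinite_cls j : infinite_set (cls j).
Proof.
apply/infinite_setP => N; exists (N * m + j)%N.
  by apply: leq_trans _ (leq_addr _ _); exact: leq_pmulr.
by rewrite /cls /residue_class /= modnMDl.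
Qed.

Lemma cls_eq j k x : cls j x -> cls k x -> cls j = cls k.
Proof.
rewrite /cls /residue_class /= => xj xk.
by apply/seteqP; split=> y /= ->; rewrite -xj -xk.
Qed.

Lemma infinite_cls_eq A j k :
  infinite_set (A `&` cls j `&` cls k) -> cls k = cls j.
Proof.
by move/infinite_setP/(_ 0%N) => [x _ [[_ xj] xk]]; exact: cls_eq xk xj.
Qed.

Lemma sub_infinite (A B : set nat) :
  A `<=` B -> infinite_set A -> infinite_set B.
Proof. by move=> AB Ainf Bfin; apply: Ainf; exact: sub_finite_set Bfin. Qed.

Lemma almost_closed_part A j : almost_closed Y A ->
  infinite_set (A `&` cls j) -> almost_closed Y (A `&` cls j).
Proof.
move=> /almost_closed_upE[Areg _] Aj; apply/almost_closed_upE; split.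
  move=> k /infinite_cls_eq kj; rewrite kj => nAj; apply: (Areg j) => //.
  by apply: sub_infinite nAj => x [nA xj]; split=> // Ax; exact: nA.
by exists j; rewrite -setIA setIid.
Qed.

(** Almost closed subsets of [A] and [cls j] can only be infinite inside [cls j]; each is then
    cofinite there, and two of them cannot be disjoint. *)
Lemma atomic_part A j : almost_closed Y A ->
  infinite_set (A `&` cls j) -> atomic Y (A `&` cls j).
Proof.
move=> Aac Aj; split; first exact: almost_closed_part.
move=> [B [B' [BA BA' BB' /almost_closed_upE[Breg [k Bk]]
  /almost_closed_upE[_ [k' Bk']]]]].
have inj C l :
    C `<=` A `&` cls j -> infinite_set (C `&` cls l) -> cls l = cls j.
  move=> CA Cl; apply: (@infinite_cls_eq A).
  by apply: sub_infinite Cl => x [/CA].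
move: (Bk) (Bk'); rewrite (inj _ _ BA Bk) (inj _ _ BA' Bk') => Bj B'j.
apply: (Breg j) => //; apply: sub_infinite B'j => x [B'x xj].
by split=> // Bx; have : (B `&` B') x by []; rewrite BB'.
Qed.

Lemma almost_closed_cls j : almost_closed Y (cls j).
Proof.
apply/almost_closed_upE; split; last first.
  by exists j; rewrite setIid; exact: infinite_cls.
move=> k; rewrite -(setTI (cls j)) => /infinite_cls_eq ->.
by rewrite setTI setICl => /infinite_setP/(_ 0%N)[].
Qed.

Lemma atomic_cls j : atomic Y (cls j).
Proof.
rewrite -(setIid (cls j)); apply: atomic_part; first exact: almost_closed_cls.
by rewrite setIid; exact: infinite_cls.
Qed.

Lemma sum_eventually_in (D F : set (set nat)) : finite_set F -> F `<=` D ->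
  (forall A B, D A -> D B -> A <> B -> A `&` B = set0) ->
  (\sum_(A \in F) P (eventually_in Y A))%E =
  P (\bigcup_(A in F) eventually_in Y A).
Proof.
move=> Ffin FD Ddisj; rewrite content_fin_bigcup//.
- move=> A B FA FB [w [[N _ HA] [M _ HB]]]; apply: contrapT => AB.
  have : (A `&` B) (Y (maxn N M) w).
    by split; [apply: HA|apply: HB]; rewrite /= ?leq_maxl ?leq_maxr.
  by rewrite Ddisj//; exact: FD.
- by move=> A _; exact: measurable_eventually_in.
- apply: fin_bigcup_measurable => // A _; exact: measurable_eventually_in.
Qed.

(** Each class meets some member of [D] in an infinite set, or the total mass would fall short of
    [1]; by regularity and disjointness this member is unique. A member serving two classes would be
    nonatomic and yet contain an atomic set, so the assignment is injective. *)
Lemma card_blackwell_decomposition D :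
  blackwell_decomposition Y D -> (D #= `I_m)%card.
Proof.
move=> [Dac Ddisj _ Dnonat Dtot].
have cover j : exists A, D A /\ infinite_set (A `&` cls j).
  apply: contrapT => /forallNP noA.
  suff : (\esum_(C in D) P (eventually_in Y C) <=
      1 - P (eventually_in Y (cls j)))%E.
    rewrite Dtot leNgt; have := cls_gt0 j.
    have : P (eventually_in Y (cls j)) \is a fin_num.
      by apply: fin_num_measure; exact: measurable_eventually_in.
    case: (P (eventually_in _ _)) => // c _.
    by rewrite -EFinB !lte_fin gtrBl => ->.
  rewrite -probability_setC; last exact: measurable_eventually_in.
  apply: ge_ereal_sup => _ [F [Ffin FD] <-].
  rewrite (sum_eventually_in Ffin FD Ddisj); apply: le_prob_on_up.
  - apply: fin_bigcup_measurable => // A _; exact: measurable_eventually_in.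
  - by apply: measurableC; exact: measurable_eventually_in.
  - move=> w Uw [A FA Aw] jw; apply: (noA A); split; first exact: FD.
    by apply/(up_inf_often A Uw jw); exact: eventually_in_inf_often.
have [f Df] := choice cover.
have -> : D = f @` `I_m.
  apply/seteqP; split=> [A DA|_ [j _ <-]]; last by case: (Df j).
  have [/almost_closed_upE[_ [j Aj]] _] := conj (Dac _ DA) I.
  exists (j %% m)%N; first exact: ltn_pmod.
  apply: contrapT => fA; have [Dfj fj] := Df (j %% m)%N.
  have jE : cls (j %% m)%N = cls j.
    by apply/seteqP; split=> x; rewrite /cls /residue_class /= modn_mod.
  have [/almost_closed_upE[Areg _] _] := conj (Dac _ DA) I.
  apply: (Areg j Aj); rewrite jE in fj; apply: sub_infinite fj => x [fx xj].
  split=> // Ax; have : (f (j %% m)%N `&` A) x by [].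
  by rewrite Ddisj.
apply: inj_card_eq => j k; rewrite !inE /= => jm km fjk.
apply: contrapT => jk.
have [Dj fj] := Df j; have [Dk fk] := Df k; rewrite -fjk in fk.
have nonat : nonatomic Y (f j).
  split; first exact: Dac.
  exists (f j `&` cls j), (f j `&` cls k); split.
  - by move=> x [].
  - by move=> x [].
  - rewrite -subset0 => x [[_ xj] [_ xk]]; apply: jk.
    move: xj xk; rewrite /cls /residue_class /=.
    by rewrite (modn_small jm) (modn_small km) => <-.
  - by apply: almost_closed_part => //; exact: Dac.
  - by apply: almost_closed_part => //; exact: Dac.
have [noatom _] := Dnonat _ Dj nonat.
apply: (noatom (f j `&` cls j)); first by move=> x [].
by apply: atomic_part => //; exact: Dac.
Qed.

Lemma blackwell_decomposition_cls :
  blackwell_decomposition Y (cls @` `I_m).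
Proof.
have disj A B : (cls @` `I_m) A -> (cls @` `I_m) B -> A <> B -> A `&` B = set0.
  move=> [j _ <-] [k _ <-] jk; rewrite -subset0 => x [xj xk]; apply: jk.
  exact: cls_eq xj xk.
split=> //.
- by move=> _ [j _ <-]; exact: almost_closed_cls.
- by move=> _ B [j _ <-] _ [_ nat]; have [_ /(_ nat)] := atomic_cls j.
- by move=> _ [j _ <-] [_ nat]; have [_ /(_ nat)] := atomic_cls j.
have fin : finite_set (cls @` `I_m) by apply: finite_image; exact: finite_II.
have mbig F : finite_set F -> measurable (\bigcup_(A in F) eventually_in Y A).
  move=> Ffin; apply: fin_bigcup_measurable => // A _.
  exact: measurable_eventually_in.
apply/eqP; rewrite eq_le; apply/andP; split.
  apply: ge_ereal_sup => _ [F [Ffin FD] <-].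
  by rewrite (sum_eventually_in Ffin FD disj) probability_le1//; exact: mbig.
apply: esum_ge; exists (cls @` `I_m); first by split.
rewrite (sum_eventually_in fin _ disj)// -(@probability_setT _ _ _ P).
apply: le_prob_on_up => //; first exact: mbig.
move=> w Uw _; have [j jm jw] := up_eventually_in_class Uw.
by exists (cls j) => //; exists j.
Qed.

(** The decomposition counted is an arbitrary choice: the residue classes show that one exists, and
    every one has [m] members. *)
Lemma blackwell_number_up : blackwell_number Y = m%:R%:E.
Proof.
rewrite /blackwell_number; set D := xget _ _.
have : blackwell_decomposition Y D.
  apply: (@xgetPex _ set0 [set D | blackwell_decomposition Y D]).
  by exists (cls @` `I_m); exact: blackwell_decomposition_cls.
move/card_blackwell_decomposition => Dm.
rewrite /counting asboolT; last by exists m.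
by rewrite (card_fset_set Dm).
Qed.

End Upward_chain.

(** * Extracting three disjoint almost closed sets from the Blackwell number *)

Section Blackwell_number.
Context (R : realType) (d : measure_display) (T : measurableType d)
  (P : probability T R).

Lemma three_of_blackwell_number (Y : nat -> {RV P >-> nat}) m :
  (3 <= m)%N -> blackwell_number Y = m%:R%:E ->
  exists C : 'I_3 -> set nat, (forall k, almost_closed Y (C k)) /\
    (forall k l, k != l -> C k `&` C l = set0).
Proof.
move=> m3; rewrite /blackwell_number; set D := xget _ _ => Dm.
have [DP|] := pselect (exists D, blackwell_decomposition Y D); last first.
  (* Without any decomposition the default [set0] would be counted, giving [0], against [3 <= m]. *)
  move=> noD; move: Dm; rewrite /D xgetPN; last first.
    by move=> E HE; apply: noD; exists E.
  rewrite /counting asboolT// fset_set0 finmap.cardfs0 => -[] /eqP.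
  by rewrite eqr_nat => /eqP m0; rewrite -m0 in m3.
have := @xgetPex _ set0 [set D | blackwell_decomposition Y D] DP.
rewrite -/D /= => -[Dac Ddisj _ _ _].
move: Dm; rewrite /counting; case: asboolP => // Dfin -[] /eqP.
rewrite eqr_nat => /eqP Dsize.
have DC (k : 'I_3) : D (nth set0 (finmap.enum_fset (fset_set D)) k).
  rewrite -[X in X _](fset_setK Dfin) /= mem_nth// Dsize.
  exact: leq_trans (ltn_ord k) m3.
exists (fun k => nth set0 (finmap.enum_fset (fset_set D)) k); split.
  by move=> k; exact: Dac.
move=> k l kl; apply: Ddisj => //; apply/eqP.
rewrite nth_uniq ?finmap.fset_uniq// Dsize.
  exact: leq_trans (ltn_ord k) m3.
exact: leq_trans (ltn_ord l) m3.
Qed.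

End Blackwell_number.

Theorem theorem11 (R : realType) (p q r : nat -> R)
    (p_gt0 : forall i, 0 < p i)
    (q0 : q 0%N = 0) (q_gt0 : forall i, 0 < q i.+1)
    (r_ge0 : forall i, 0 <= r i)
    (pqr1 : forall i, p i + q i + r i = 1)
    (r_gt0 : exists i, 0 < r i)
    (d : measure_display) (T : measurableType d) (P : probability T R)
    (X : nat -> {RV P >-> nat})
    (X_bd : is_markov_chain X (birth_death_kernel p q r)) :
  asymptotic_period X = +oo%E <->
  0 < limn (fun n => \prod_(0 <= i < n) p i).
Proof.
split=> [per|lim_gt0].
  (* If only [m <= 2] occurred, the supremum would be at most [2]. *)
  have [m m3 bm] : exists2 m, (3 <= m)%N &
      blackwell_number (step_chain X m) = m%:R%:E.
    apply: contrapT => no3.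
    have : (asymptotic_period X <= 2%:R%:E)%E.
      apply: ge_ereal_sup => _ [m [m1 bm] <-]; rewrite lee_fin ler_nat leqNgt.
      by apply/negP => m3; apply: no3; exists m.
    by rewrite per.
  have [C [Cac Cdisj]] := three_of_blackwell_number m3 bm.
  apply: (lim_prod_gt0_of_summable p_gt0 q0 q_gt0 r_ge0 pqr1).
  apply: (summable_of_three_traps p_gt0 q0 q_gt0 r_ge0 pqr1 _ Cdisj).
    exact: leq_trans m3.
  move=> k; apply: (eventually_in_stay_forever p_gt0 q0 q_gt0 r_ge0 pqr1 X_bd).
  exact/almost_closed_gt0/Cac.
(* Every [m >= 1] belongs to the set whose supremum is taken, so an [m] above any given [A]
   suffices. *)
apply/eqyP => A A0; pose m := (Num.bound A).+1.
apply: (@le_trans _ _ (m%:R%:E)).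
  rewrite lee_fin ltW// (lt_trans (archi_boundP (ltW A0)))// ltr_nat.
  exact: leqnn.
apply: ereal_sup_ubound; exists m => //; split=> //.
apply: blackwell_number_up => //.
  exact: (ultimately_up_ae p_gt0 q0 q_gt0 r_ge0 pqr1 X_bd).
move=> j; exact: (residue_class_gt0 p_gt0 q0 q_gt0 r_ge0 pqr1 X_bd lim_gt0 j).
Qed.
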